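(* Let $R$ be a commutative ring and $F = F(t)\in R[t]^{l\times m}$. If $F(t)\sim F(0)$ over $R_{\mathfrak m}[t]$ for all maximal ideals $\mathfrak m$ of $R$, then $F(t)\sim F(0)$ over $R[t]$.
   Context: For a commutative ring $C$ and $l\times m$ matrices $F,G$ over $C$, $F\sim G$ over $C$ means that there exist $U\in\mathrm{GL}_l(C)$ and $V\in\mathrm{GL}_m(C)$ with $F = UGV$. $R_{\mathfrak m}$ is the localization of $R$ at $\mathfrak m$; ''$F(t)\sim F(0)$ over $R_{\mathfrak m}[t]$'' refers to the images of $F(t)$ and $F(0)$ under the natural map $R[t]\to R_{\mathfrak m}[t]$ applied entrywise. $F(0)$ is obtained from $F(t)$ by substituting $t=0$. *)

(* Defs.v *)
From HB Require Import structures.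
From mathcomp Require Import all_boot all_order all_algebra.
From mathcomp Require Import generic_quotient ring_quotient.
From mathcomp Require Import boolp ring.

Set Implicit Arguments.
Unset Strict Implicit.
Unset Printing Implicit Defensive.

Import GRing.Theory.

Local Open Scope ring_scope.
Local Open Scope quotient_scope.

(* [idealr R] is the type of proper ideals of [R], so these are its maximal
   elements for inclusion.  Ideals are boolean predicates, but the classical
   axioms of boolp turn any predicate into a boolean one. *)
Definition maximal_ideal (R : comNzRingType) (I : idealr R) : Prop :=
  forall J : idealr R, {subset I <= J} -> {subset J <= I}.

Section MaximalPrime.
Variables (R : comNzRingType) (m : idealr R) (m_max : maximal_ideal m).

Lemma maximal_ideal_prime : prime_idealr_closed m.
Proof.
move=> u v uv_m; have [//|u_nm] := boolP (u \in m); rewrite /=.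
pose S : {pred R} := fun x => `[< exists2 a, a \in m & exists c, x = a + c * u >].
have SP x : reflect (exists2 a, a \in m & exists c, x = a + c * u) (x \in S).
  exact: asboolP.
have [/SP[a a_m [c one_eq]]|S1] := boolP (1 \in S).
  rewrite -[v]mul1r one_eq mulrDl -mulrA rpredD //; last exact: idealMr.
  by rewrite mulrC idealMr.
have S_ideal : idealr_closed S.
  split=> //; first by apply/SP; exists 0; [exact: rpred0 | exists 0; rewrite mul0r addr0].
  move=> r _ _ /SP[a a_m [c ->]] /SP[b b_m [d ->]]; apply/SP.
  exists (r * a + b); first by rewrite rpredD ?idealMr.
  by exists (r * c + d); rewrite mulrDr mulrDl addrACA !mulrA.
pose J : idealr R := HB.pack S (isIdealr.Build R S S_ideal).
have mJ : {subset m <= J}.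
  by move=> a a_m; apply/SP; exists a => //; exists 0; rewrite mul0r addr0.
case/negP: u_nm; apply: (m_max mJ); apply/SP.
by exists 0; [exact: rpred0 | exists 1; rewrite mul1r add0r].
Qed.

Definition maximal_prime : prime_idealr R :=
  HB.pack (m : R -> bool) (Idealr.class m)
    (isPrimeIdealrClosed.Build R m maximal_ideal_prime).

End MaximalPrime.

Section Localization.
Variables (R : comNzRingType) (p : prime_idealr R).

Record locfrac := LocFrac { locpair :> R * R; locden : locpair.2 \notin p }.

HB.instance Definition _ := [isSub for locpair].
HB.instance Definition _ := [Choice of locfrac by <:].

Implicit Types x y z : locfrac.

Lemma notin_prime1 : 1 \notin p.
Proof. by rewrite idealr1. Qed.

Lemma notin_primeM (s t : R) : s \notin p -> t \notin p -> s * t \notin p.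
Proof. by move=> sp tp; rewrite prime_idealrM negb_or sp. Qed.

(* [R] may have zero divisors, hence the extra factor [w]. *)
Definition loc_equiv x y : bool :=
  `[< exists2 w, w \notin p & w * (x.1 * y.2) = w * (y.1 * x.2) >].

Lemma loc_equivP x y :
  reflect (exists2 w, w \notin p & w * (x.1 * y.2) = w * (y.1 * x.2))
          (loc_equiv x y).
Proof. exact: asboolP. Qed.

Lemma loc_equiv_refl : reflexive loc_equiv.
Proof. by move=> x; apply/loc_equivP; exists 1; rewrite // notin_prime1. Qed.

Lemma loc_equiv_sym : symmetric loc_equiv.
Proof. by move=> x y; apply/loc_equivP/loc_equivP => -[w wp e]; exists w. Qed.

Lemma loc_equiv_trans : transitive loc_equiv.
Proof.
move=> y x z /loc_equivP[w wp xy] /loc_equivP[w' w'p yz]; apply/loc_equivP.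
exists (w * w' * y.2); first by rewrite !notin_primeM ?locden.
have -> : w * w' * y.2 * (x.1 * z.2) = w' * z.2 * (w * (x.1 * y.2)) by ring.
have -> : w * w' * y.2 * (z.1 * x.2) = w * x.2 * (w' * (z.1 * y.2)) by ring.
by rewrite xy -yz; ring.
Qed.

Canonical loc_equiv_equiv :=
  EquivRel loc_equiv loc_equiv_refl loc_equiv_sym loc_equiv_trans.

Definition localization := {eq_quot loc_equiv}.

HB.instance Definition _ : EqQuotient _ loc_equiv localization :=
  EqQuotient.on localization.
HB.instance Definition _ := Choice.on localization.

Lemma eq_locP x y : reflect (\pi_localization x = \pi y) (loc_equiv x y).
Proof. by apply: (iffP idP) => [h|/eqmodP]; first exact/eqmodP. Qed.

Lemma loc_repr x : loc_equiv (repr (\pi_localization x)) x.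
Proof. by apply/eq_locP; rewrite reprK. Qed.

Definition embed_frac (a : R) : locfrac := @LocFrac (a, 1) notin_prime1.

Definition add_frac x y : locfrac :=
  @LocFrac (x.1 * y.2 + y.1 * x.2, x.2 * y.2)
           (notin_primeM (locden x) (locden y)).

Definition opp_frac x : locfrac := @LocFrac (- x.1, x.2) (locden x).

Definition mul_frac x y : locfrac :=
  @LocFrac (x.1 * y.1, x.2 * y.2) (notin_primeM (locden x) (locden y)).

Definition loc_zero : localization := \pi_localization (embed_frac 0).
Definition loc_one : localization := \pi_localization (embed_frac 1).
Definition loc_add := lift_op2 localization add_frac.
Definition loc_opp := lift_op1 localization opp_frac.
Definition loc_mul := lift_op2 localization mul_frac.

Lemma pi_loc_add : {morph \pi : x y / add_frac x y >-> loc_add x y}.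
Proof.
move=> x y; unlock loc_add; apply/esym/eq_locP/loc_equivP => /=.
have /loc_equivP[w wp ex] := loc_repr x; have /loc_equivP[v vp ey] := loc_repr y.
move: (repr _) (repr _) ex ey => y' x' ex ey.
exists (w * v); first exact: notin_primeM.
rewrite [LHS](_ : _ = v * y'.2 * y.2 * (w * (x'.1 * x.2))
                 + w * x'.2 * x.2 * (v * (y'.1 * y.2))); last by ring.
by rewrite ex ey; ring.
Qed.

Lemma pi_loc_opp : {morph \pi : x / opp_frac x >-> loc_opp x}.
Proof.
move=> x; unlock loc_opp; apply/esym/eq_locP/loc_equivP => /=.
have /loc_equivP[w wp ex] := loc_repr x; exists w => //.
by rewrite !mulNr !mulrN ex.
Qed.

Lemma pi_loc_mul : {morph \pi : x y / mul_frac x y >-> loc_mul x y}.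
Proof.
move=> x y; unlock loc_mul; apply/esym/eq_locP/loc_equivP => /=.
have /loc_equivP[w wp ex] := loc_repr x; have /loc_equivP[v vp ey] := loc_repr y.
move: (repr _) (repr _) ex ey => y' x' ex ey.
exists (w * v); first exact: notin_primeM.
rewrite [LHS](_ : _ = (w * (x'.1 * x.2)) * (v * (y'.1 * y.2))); last by ring.
by rewrite ex ey; ring.
Qed.

Lemma loc_eq_num x y : x.1 * y.2 = y.1 * x.2 -> \pi_localization x = \pi y.
Proof.
by move=> e; apply/eq_locP/loc_equivP; exists 1; rewrite ?notin_prime1 ?e.
Qed.

Lemma loc_addA : associative loc_add.
Proof.
elim/quotW=> x; elim/quotW=> y; elim/quotW=> z.
by rewrite -!pi_loc_add; apply: loc_eq_num => /=; ring.
Qed.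

Lemma loc_addC : commutative loc_add.
Proof.
elim/quotW=> x; elim/quotW=> y.
by rewrite -!pi_loc_add; apply: loc_eq_num => /=; ring.
Qed.

Lemma loc_add0 : left_id loc_zero loc_add.
Proof.
by elim/quotW=> x; rewrite -pi_loc_add; apply: loc_eq_num => /=; ring.
Qed.

Lemma loc_addN : left_inverse loc_zero loc_opp loc_add.
Proof.
elim/quotW=> x.
by rewrite -pi_loc_opp -pi_loc_add; apply: loc_eq_num => /=; ring.
Qed.

HB.instance Definition _ :=
  GRing.isZmodule.Build localization loc_addA loc_addC loc_add0 loc_addN.

Lemma loc_mulA : associative loc_mul.
Proof.
elim/quotW=> x; elim/quotW=> y; elim/quotW=> z.
by rewrite -!pi_loc_mul; apply: loc_eq_num => /=; ring.
Qed.

Lemma loc_mulC : commutative loc_mul.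
Proof.
elim/quotW=> x; elim/quotW=> y.
by rewrite -!pi_loc_mul; apply: loc_eq_num => /=; ring.
Qed.

Lemma loc_mul1 : left_id loc_one loc_mul.
Proof.
by elim/quotW=> x; rewrite -pi_loc_mul; apply: loc_eq_num => /=; ring.
Qed.

Lemma loc_mulDl : left_distributive loc_mul loc_add.
Proof.
elim/quotW=> x; elim/quotW=> y; elim/quotW=> z.
rewrite -!(pi_loc_add, pi_loc_mul).
by apply: loc_eq_num => /=; ring.
Qed.

Lemma loc_one_neq0 : loc_one != loc_zero.
Proof.
apply/eqP => /eq_locP/loc_equivP[w wp] /=.
by rewrite !mulr1 mulr0 => w0; rewrite w0 rpred0 in wp.
Qed.

HB.instance Definition _ := GRing.Zmodule_isComNzRing.Build localization
  loc_mulA loc_mulC loc_mul1 loc_mulDl loc_one_neq0.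

Definition toloc (a : R) : localization := \pi_localization (embed_frac a).

Lemma toloc_is_zmod_morphism : zmod_morphism toloc.
Proof.
move=> a b; rewrite -[RHS]/(loc_add _ (loc_opp _)) -pi_loc_opp -pi_loc_add.
by apply: loc_eq_num => /=; ring.
Qed.

HB.instance Definition _ :=
  GRing.isZmodMorphism.Build R localization toloc toloc_is_zmod_morphism.

Lemma toloc_is_monoid_morphism : monoid_morphism toloc.
Proof.
split=> [//|a b]; rewrite /toloc -[RHS]pi_loc_mul.
by apply: loc_eq_num => /=; ring.
Qed.

HB.instance Definition _ :=
  GRing.isMonoidMorphism.Build R localization toloc toloc_is_monoid_morphism.

Lemma toloc_eqP (a b : R) :
  reflect (exists2 w, w \notin p & w * a = w * b) (toloc a == toloc b).
Proof.
apply: (iffP eqP) => [/eq_locP/loc_equivP|] [w wp] /=.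
  by rewrite !mulr1; exists w.
by move=> e; apply/eq_locP/loc_equivP; exists w; rewrite //= !mulr1.
Qed.

Lemma toloc_inv (s : R) : s \notin p -> exists u : localization, toloc s * u = 1.
Proof.
move=> sp; exists (\pi_localization (@LocFrac (1, s) sp)); rewrite -[LHS]pi_loc_mul.
by apply: loc_eq_num => /=; ring.
Qed.

Lemma toloc_frac (u : localization) :
  exists a, exists2 s, s \notin p & u * toloc s = toloc a.
Proof.
elim/quotW: u => x; exists x.1, x.2; first exact: locden.
by rewrite -[LHS]pi_loc_mul; apply: loc_eq_num => /=; ring.
Qed.

End Localization.

(* [unitmx] is not usable here: it requires a [comUnitRingType], and
   [{poly R}] is not one when [R] is not an integral domain. *)
Definition invertible_mx (C : comNzRingType) (n : nat) (U : 'M[C]_n) : Prop :=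
  exists V : 'M[C]_n, U *m V = 1%:M /\ V *m U = 1%:M.

Definition equivalent_mx (C : comNzRingType) (l m : nat) (F G : 'M[C]_(l, m)) :
    Prop :=
  exists (U : 'M[C]_l) (V : 'M[C]_m),
    [/\ invertible_mx U, invertible_mx V & F = U *m G *m V].

Definition at0_mx (R : comNzRingType) (l m : nat) (F : 'M[{poly R}]_(l, m)) :
    'M[{poly R}]_(l, m) :=
  map_mx (fun f : {poly R} => (f.[0])%:P) F.

Definition localize_mx (R : comNzRingType) (p : prime_idealr R) (l m : nat)
    (F : 'M[{poly R}]_(l, m)) : 'M[{poly localization p}]_(l, m) :=
  map_mx (map_poly (@toloc R p)) F.

(* Main.v *)
Require Import Defs.
From HB Require Import structures.
From mathcomp Require Import all_boot all_order all_algebra.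
From mathcomp Require Import ring_quotient.
From mathcomp Require Import boolp classical_sets.

Set Implicit Arguments.
Unset Strict Implicit.
Unset Printing Implicit Defensive.

Import GRing.Theory.
Local Open Scope ring_scope.

(* Following Vaserstein, the elements [a] of [R] such that F(x + a y) ~ F(x) over
   R[x, y] form an ideal, and it suffices to show that it contains 1: then put
   x = 0.  Otherwise it lies in a maximal ideal [m].  From F(t) = U(t) F(0) V(t)
   over R_m[t] one gets F(x + y) = U(x + y) U(x)^-1 F(x) V(x)^-1 V(x + y).  The
   two outer factors are 1 at y = 0, so for a suitable [s] outside [m] the
   substitution y := s y clears all their denominators.  The lifted identities
   may fail over R[x, y], but the errors vanish both at y = 0 and over
   R_m[x, y], so a further substitution y := w y with [w] outside [m] kills
   them.  Hence s w belongs to the ideal, a contradiction. *)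

(** * Equivalence of matrices over a commutative ring *)

Section Equivalence.
Variable C : comNzRingType.

Lemma invertible_mxM n (U V : 'M[C]_n) :
  invertible_mx U -> invertible_mx V -> invertible_mx (U *m V).
Proof.
move=> [U' [UU' U'U]] [V' [VV' V'V]]; exists (V' *m U'); split.
  by rewrite mulmxA -(mulmxA U) VV' mulmx1.
by rewrite mulmxA -(mulmxA V') U'U mulmx1.
Qed.

Lemma equivalent_mx_refl l m (F : 'M[C]_(l, m)) : equivalent_mx F F.
Proof.
have inv1 n : invertible_mx (1%:M : 'M[C]_n) by exists 1%:M; rewrite mulmx1.
by exists 1%:M, 1%:M; split; rewrite // mul1mx mulmx1.
Qed.

Lemma equivalent_mx_trans l m (F G H : 'M[C]_(l, m)) :
  equivalent_mx F G -> equivalent_mx G H -> equivalent_mx F H.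
Proof.
move=> [U [V [Uinv Vinv ->]]] [U1 [V1 [U1inv V1inv ->]]].
exists (U *m U1), (V1 *m V); split; [exact: invertible_mxM.. | by rewrite !mulmxA].
Qed.

End Equivalence.

Lemma invertible_mx_map (C D : comNzRingType) (f : {rmorphism C -> D}) n
    (U : 'M[C]_n) :
  invertible_mx U -> invertible_mx (map_mx f U).
Proof.
by case=> V [UV VU]; exists (map_mx f V); rewrite -!map_mxM UV VU map_mx1.
Qed.

Lemma equivalent_mx_map (C D : comNzRingType) (f : {rmorphism C -> D}) l m
    (F G : 'M[C]_(l, m)) :
  equivalent_mx F G -> equivalent_mx (map_mx f F) (map_mx f G).
Proof.
move=> [U [V [Uinv Vinv ->]]]; exists (map_mx f U), (map_mx f V).
by split; [exact: invertible_mx_map.. | rewrite !map_mxM].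
Qed.

(** * Conditions met at all multiples of an element of a multiplicative set *)

Section Multiples.
Variables (R : comNzRingType) (S : {pred R}) (S_closed : mulr_closed S).

(** Stability under multiples lets finitely many such conditions be met at once: the product of
    their witnesses is a multiple of each of them. *)
Definition at_multiples (P : R -> Prop) : Prop :=
  exists2 s, s \in S & {in S, forall t, P (t * s)}.

Lemma at_multiples_ex P : at_multiples P -> exists2 s, s \in S & P s.
Proof.
by case=> s sS /(_ 1 S_closed.1); rewrite mul1r; exists s.
Qed.

Lemma at_multiplesW (P Q : R -> Prop) :
  (forall s, P s -> Q s) -> at_multiples P -> at_multiples Q.
Proof. by move=> PQ [s sS Ps]; exists s => // t /Ps/PQ. Qed.

Lemma at_multiples_and (P Q : R -> Prop) :
  at_multiples P -> at_multiples Q -> at_multiples (fun s => P s /\ Q s).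
Proof.
move=> [s sS Ps] [t tS Qt]; exists (s * t); first exact: S_closed.2.
move=> u uS; split; last by rewrite mulrA; apply/Qt/S_closed.2.
by rewrite [s * t]mulrC mulrA; apply/Ps/S_closed.2.
Qed.

Lemma at_multiples_forall (I : finType) (P : I -> R -> Prop) :
  (forall i, at_multiples (P i)) -> at_multiples (fun s => forall i, P i s).
Proof.
move=> /(_ _)/cid2-/all_sig[s /all_and2[sS Ps]].
have prodS (Q : pred I) : \prod_(i | Q i) s i \in S.
  by apply: (big_ind (fun x => x \in S)) => //; [exact: S_closed.1 | exact: S_closed.2].
exists (\prod_i s i) => // t tS i; rewrite (bigD1 i) //= [s i * _]mulrC mulrA.
exact/Ps/S_closed.2.
Qed.

End Multiples.

(** * Localization maps on matrices and polynomials *)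

Section FractionMap.
Variables (R : comNzRingType) (S : {pred R}) (S_closed : mulr_closed S).

(* Elements of [S] act on [B] through [r]; this keeps the two halves of "[h] is
   the localization of [B] at [S]" that do not involve inverses, in a form that
   passes to polynomial rings. *)
Definition fraction_map (B C : comNzRingType) (r : R -> B) (h : B -> C) : Prop :=
  (forall b, h b = 0 -> at_multiples S (fun s => r s * b = 0)) /\
  (forall u, at_multiples S (fun s => exists b, h b = h (r s) * u)).

Section FractionMatrix.
Variables (B C : comNzRingType) (r : {rmorphism R -> B}) (h : {rmorphism B -> C}).
Hypothesis h_frac : fraction_map r h.

Lemma fraction_map_kermx l m (Q : 'M[B]_(l, m)) :
  map_mx h Q = 0 -> at_multiples S (fun s => r s *: Q = 0).
Proof.
move=> hQ0.
have := @at_multiples_forall _ _ S_closed ('I_l * 'I_m)%type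
  (fun ij s => r s * Q ij.1 ij.2 = 0).
case=> [[i j]|s sS sQ].
  by apply: h_frac.1 => /=; move/matrixP/(_ i j): hQ0; rewrite !mxE.
by exists s => // t /sQ tsQ; apply/matrixP=> i j; rewrite !mxE (tsQ (i, j)).
Qed.

Lemma fraction_map_mx l m (Q : 'M[C]_(l, m)) :
  at_multiples S (fun s => exists P, map_mx h P = h (r s) *: Q).
Proof.
have := @at_multiples_forall _ _ S_closed ('I_l * 'I_m)%type
  (fun ij s => exists b, h b = h (r s) * Q ij.1 ij.2).
case=> [[i j]|s sS sQ]; first exact: h_frac.2.
exists s => // t /sQ /(_ _)/cid-/all_sig[b bE].
by exists (\matrix_(i, j) b (i, j)); apply/matrixP=> i j; rewrite !mxE bE.
Qed.

(** A polynomial has finitely many coefficients, so one [s] serves them all. Used twice in a row,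
    this passes from R to R[x] and then to R[x, y]. *)
Lemma fraction_map_poly : fraction_map (polyC \o r) (map_poly h).
Proof.
split=> [p hp0|u].
  have := @at_multiples_forall _ _ S_closed 'I_(size p) (fun i s => r s * p`_i = 0).
  case=> [i|s sS sp].
    by apply: h_frac.1; move/polyP/(_ i): hp0; rewrite coef_map coef0.
  exists s => // t /sp tsp; apply/polyP=> i; rewrite coefCM coef0.
  have [i_lt|i_ge] := ltnP i (size p); first exact: (tsp (Ordinal i_lt)).
  by rewrite nth_default ?mulr0.
have := @at_multiples_forall _ _ S_closed 'I_(size u)
  (fun i s => exists b, h b = h (r s) * u`_i).
case=> [i|s sS su]; first exact: h_frac.2.
exists s => // t /su /(_ _)/cid-/all_sig[b bE].
(* [b] is indexed by ordinals; the default 0 is never reached, since [i < size u]. *)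
exists (\poly_(i < size u) oapp b 0 (insub i)).
apply/polyP=> i; rewrite coef_map coef_poly /= map_polyC coefCM.
case: ltnP => [i_lt|i_ge]; last by rewrite rmorph0 nth_default ?mulr0.
by rewrite insubT /= bE.
Qed.

End FractionMatrix.
End FractionMap.

(** * Dilations of the variable *)

Definition dilation (C : comNzRingType) (c : C) : {poly C} -> {poly C} :=
  comp_poly (c%:P * 'X).

HB.instance Definition _ (C : comNzRingType) (c : C) :=
  GRing.RMorphism.on (dilation c).

Section Dilation.
Variable C : comNzRingType.
Implicit Types (c d : C) (p : {poly C}).

Lemma dilationC c d : dilation c d%:P = d%:P.
Proof. exact: comp_polyC. Qed.

Lemma dilationM c d p : dilation c (dilation d p) = dilation (d * c) p.
Proof.
rewrite /dilation -comp_polyA comp_polyM comp_polyC comp_polyX mulrA.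
by rewrite -polyCM.
Qed.

Lemma horner0_dilation c p : (dilation c p).[0] = p.[0].
Proof. by rewrite horner_comp !hornerE. Qed.

Lemma map_dilation (D : comNzRingType) (h : {rmorphism C -> D}) c p :
  map_poly h (dilation c p) = dilation (h c) (map_poly h p).
Proof. by rewrite map_comp_poly rmorphM /= map_polyC map_polyX. Qed.

Lemma polyXM_drop p : p = p.[0]%:P + 'X * drop_poly 1 p.
Proof.
apply/polyP=> i; rewrite coefD coefC coefXM coef_drop_poly horner_coef0.
by case: i => [|i]; rewrite ?addr0 ?add0r //= addn1.
Qed.

End Dilation.

(** * Lifting from the localization after a dilation *)

Section Lifting.
Variables (R B C : comNzRingType) (S : {pred R}) (S_closed : mulr_closed S).
Variables (r : {rmorphism R -> B}) (h : {rmorphism B -> C}).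
Hypothesis h_frac : fraction_map S r h.

Local Notation hX := (map_poly h).
Local Notation dil s := (map_mx (dilation (r s))).

(** Unlike [at0_mx], this takes its values in the coefficient ring. *)
Let at0 {A : comNzRingType} {l m} (M : 'M[{poly A}]_(l, m)) :=
  map_mx (horner_eval 0) M.

Let hX_frac := fraction_map_poly S_closed h_frac.

(** Write N = y D(y). Then D also dies under [hX], so some s kills it, and N(s y) = s y D(s y)
    contains exactly this factor s. *)
Lemma kernel_dilation l m (N : 'M[{poly B}]_(l, m)) :
  at0 N = 0 -> map_mx hX N = 0 ->
  at_multiples S (fun s => dil s N = 0).
Proof.
move=> N0 hN0; pose D := map_mx (drop_poly 1) N.
have ND i j : N i j = 'X * D i j.
  rewrite {1}[N i j]polyXM_drop !mxE; move/matrixP/(_ i j): N0; rewrite !mxE.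
  by rewrite horner_evalE => ->; rewrite add0r.
have hD0 : map_mx hX D = 0.
  apply/matrixP=> i j; rewrite [LHS]mxE [RHS]mxE; apply/polyP=> k.
  (* Multiplication by ['X] shifts degrees: coefficient [k] of [D] is coefficient [k.+1] of [N]. *)
  have /polyP/(_ k.+1) : hX (N i j) = 0 by move/matrixP/(_ i j): hN0; rewrite !mxE.
  by rewrite ND rmorphM /= map_polyX coefXM !coef0.
apply: at_multiplesW (fraction_map_kermx S_closed hX_frac hD0) => s sD0.
apply/matrixP=> i j; rewrite !mxE ND rmorphM /= {1}/dilation comp_polyX.
rewrite mulrAC mulrC -[X in _ * (X * _)](dilationC (r s)) -rmorphM /=.
by move/matrixP/(_ i j): sD0; rewrite !mxE /= => ->; rewrite rmorph0 mulr0.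
Qed.

(** Write M = 1 + y D(y). Then M(s y) = 1 + y (s D)(s y), and s can be chosen to clear the
    denominators of D; the constant term 1 needs no clearing. *)
Lemma lift_dilation n (M : 'M[{poly C}]_n) :
  at0 M = 1%:M ->
  at_multiples S (fun s => exists2 N : 'M[{poly B}]_n,
    at0 N = 1%:M & map_mx hX N = map_mx (dilation (h (r s))) M).
Proof.
move=> M1; pose D := map_mx (drop_poly 1) M.
have MD : M = 1%:M + 'X *: D.
  apply/matrixP=> i j; rewrite {1}[M i j]polyXM_drop !mxE; congr (_ + _).
  by move/matrixP/(_ i j): M1; rewrite !mxE horner_evalE => ->; rewrite rmorph_nat.
apply: at_multiplesW (fraction_map_mx S_closed hX_frac D) => s [P hP].
exists (1%:M + 'X *: dil s P).
  apply/matrixP=> i j; rewrite !mxE horner_evalE hornerD hornerM hornerX mul0r.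
  by rewrite addr0 -[X in X.[_]]polyC_natr hornerC.
rewrite MD; apply/matrixP=> i j; rewrite !mxE !rmorphD /= !rmorph_nat.
congr (_ + _); rewrite !rmorphM /= map_polyX map_dilation.
move/matrixP/(_ i j): hP; rewrite !mxE /= map_polyC /= => ->.
by rewrite rmorphM /= dilationC {2}/dilation comp_polyX mulrCA mulrA.
Qed.

Lemma equivalent_mx_dilation l m (K : 'M[{poly B}]_(l, m)) (G : 'M[B]_(l, m))
    (U U' : 'M[{poly C}]_l) (V V' : 'M[{poly C}]_m) :
  at0 K = G -> at0 U = 1%:M -> at0 V = 1%:M ->
  U *m U' = 1%:M -> U' *m U = 1%:M -> V *m V' = 1%:M -> V' *m V = 1%:M ->
  map_mx hX K = U *m map_mx hX (map_mx polyC G) *m V ->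
  exists2 s, s \in S &
    equivalent_mx (dil s K) (map_mx polyC G).
Proof.
move=> K0 U1 V1 UU' U'U VV' V'V hK.
have at0M (A : comNzRingType) a b c (P : 'M[{poly A}]_(a, b)) (Q : 'M_(b, c)) :
  at0 (P *m Q) = at0 P *m at0 Q by exact: map_mxM.
have at01 (A : comNzRingType) n : at0 (1%:M : 'M[{poly A}]_n) = 1%:M.
  exact: map_mx1.
have U'1 : at0 U' = 1%:M by rewrite -(at01 _ l) -UU' at0M U1 mul1mx.
have V'1 : at0 V' = 1%:M by rewrite -(at01 _ m) -VV' at0M V1 mul1mx.
(* First dilation: one [s] lifts both outer factors and their inverses. *)
have [s sS [[[u u1 hu] [u' u'1 hu']] [[v v1 hv] [v' v'1 hv']]]] :=
  at_multiples_ex S_closed (at_multiples_and S_closed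
    (at_multiples_and S_closed (lift_dilation U1) (lift_dilation U'1))
    (at_multiples_and S_closed (lift_dilation V1) (lift_dilation V'1))).
have inverse_lift n (P Q : 'M[{poly C}]_n) (p q : 'M[{poly B}]_n) :
    P *m Q = 1%:M -> at0 p = 1%:M -> at0 q = 1%:M ->
    map_mx hX p = map_mx (dilation (h (r s))) P ->
    map_mx hX q = map_mx (dilation (h (r s))) Q ->
    at_multiples S (fun w => dil w (p *m q - 1%:M) = 0).
  move=> PQ p1 q1 hp hq; apply: kernel_dilation.
    by rewrite /at0 map_mxB map_mx1 -/(at0 _) at0M p1 q1 mul1mx subrr.
  by rewrite map_mxB map_mx1 map_mxM hp hq -map_mxM PQ map_mx1 subrr.
have err : at_multiples S (fun w => dil w
    (dil s K - u *m map_mx polyC G *m v) = 0).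
  apply: kernel_dilation.
    rewrite /at0 map_mxB -!/(at0 _) !at0M u1 v1 mul1mx mulmx1.
    apply/matrixP=> i j; rewrite -K0 !mxE !horner_evalE hornerC.
    by rewrite horner0_dilation subrr.
  rewrite map_mxB !map_mxM hu hv.
  have -> : map_mx hX (dil s K) =
            map_mx (dilation (h (r s))) (map_mx hX K).
    by apply/matrixP=> i j; rewrite !mxE map_dilation.
  rewrite hK !map_mxM.
  have -> : map_mx (dilation (h (r s))) (map_mx hX (map_mx polyC G)) =
            map_mx hX (map_mx polyC G).
    by apply/matrixP=> i j; rewrite !mxE map_polyC dilationC.
  by rewrite subrr.
(* Second dilation: one [w] kills the errors in the four inverse relations and in the
   factorization. *)
have [w wS [[[uu' u'u] [vv' v'v]] eK]] :=
  at_multiples_ex S_closed (at_multiples_and S_closed (at_multiples_and S_closed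
    (at_multiples_and S_closed
      (inverse_lift _ _ _ _ _ UU' u1 u'1 hu hu')
      (inverse_lift _ _ _ _ _ U'U u'1 u1 hu' hu))
    (at_multiples_and S_closed
      (inverse_lift _ _ _ _ _ VV' v1 v'1 hv hv')
      (inverse_lift _ _ _ _ _ V'V v'1 v1 hv' hv))) err).
have inv n (p q : 'M[{poly B}]_n) :
    dil w (p *m q - 1%:M) = 0 -> dil w p *m dil w q = 1%:M.
  by rewrite map_mxB map_mx1 map_mxM => /eqP; rewrite subr_eq0 => /eqP.
exists (s * w); first exact: S_closed.2.
exists (dil w u), (dil w v); split; [by exists (dil w u'); split; apply: inv |
  by exists (dil w v'); split; apply: inv | ].
have -> : map_mx polyC G = dil w (map_mx polyC G).
  by apply/matrixP=> i j; rewrite !mxE dilationC.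
rewrite -!map_mxM; move/eqP: eK; rewrite map_mxB subr_eq0 => /eqP <-.
by apply/matrixP=> i j; rewrite !mxE /= dilationM rmorphM.
Qed.

End Lifting.

(** * The ideal of admissible translations *)

Section Patching.
Variables (R : comNzRingType) (l m : nat) (F : 'M[{poly R}]_(l, m)).

Definition eval_mx (A : comNzRingType) (phi : {rmorphism R -> A}) (x : A) :
    'M[A]_(l, m) :=
  map_mx (horner_eval x \o map_poly phi) F.

(* Quantifying over all values of [x] and [y] in all [R]-algebras amounts to
   [F(x + a y) ~ F(x)] over the polynomial ring [R[x, y]]. *)
Definition translation_ideal : {pred R} := fun a =>
  `[< forall (A : comNzRingType) (phi : {rmorphism R -> A}) (x y : A),
        equivalent_mx (eval_mx phi (x + phi a * y)) (eval_mx phi x) >].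

Lemma translation_idealP a :
  reflect (forall (A : comNzRingType) (phi : {rmorphism R -> A}) (x y : A),
             equivalent_mx (eval_mx phi (x + phi a * y)) (eval_mx phi x))
          (a \in translation_ideal).
Proof. exact: asboolP. Qed.

(** For linear combinations, F(x + (c a + b) y) = F((x + b y) + a (c y)) ~ F(x + b y) ~ F(x), which
    uses the freedom to choose both points. *)
Lemma translation_ideal_closed :
  1 \notin translation_ideal -> idealr_closed translation_ideal.
Proof.
move=> J1; split=> //.
  apply/translation_idealP=> A phi x y.
  by rewrite rmorph0 mul0r addr0; exact: equivalent_mx_refl.
move=> c a b /translation_idealP Ja /translation_idealP Jb.
apply/translation_idealP=> A phi x y; apply: equivalent_mx_trans (Jb A phi x y).
rewrite rmorphD rmorphM mulrDl -mulrA mulrCA addrCA addrC.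
exact: Ja.
Qed.

Lemma translation_ideal1 : 1 \in translation_ideal -> equivalent_mx F (at0_mx F).
Proof.
(* In the algebra R[t], translate from 0 by t. *)
move=> /translation_idealP/(_ _ (polyC : {rmorphism R -> {poly R}}) 0 'X).
rewrite rmorph1 mul1r add0r; congr equivalent_mx; apply/matrixP=> i j.
  by rewrite !mxE /= horner_evalE -/(_ \Po _) comp_polyXr.
by rewrite !mxE /= horner_evalE -/(_ \Po _) comp_polyCr.
Qed.

End Patching.

(** * Existence of maximal ideals *)

Lemma maximal_ideal_over (R : comNzRingType) (J : {pred R}) :
  idealr_closed J ->
  exists2 I : idealr R, maximal_ideal I & {subset J <= I}.
Proof.
move=> [J0 J1 JM].
(* Adjoining [J] makes the union of the empty chain an ideal. *)
pose T (A : set R) : {pred R} := fun x => `[< A x >] || (x \in J).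
have TP A x : reflect (A x \/ x \in J) (x \in T A).
  by apply: (iffP orP) => -[/asboolP|]; by [left | right].
have [chain chainT chain_tot|A [TA A_max]] :=
    @Zorn_bigcup R (fun A => idealr_closed (T A)).
  split; first by apply/TP; right.
    apply/TP=> -[[A chA A1]|]; last exact/negP.
    by have [_ /negP[]] := chainT A chA; apply/TP; left.
  have ub A : chain A -> forall a, {in T A &, forall u v,
      a * u + v \in T (\bigcup_(X in chain) X)%classic}.
    move=> chA a u v uA vA; have [_ _ /(_ a u v uA vA)/TP[w|w]] := chainT A chA.
      by apply/TP; left; exists A.
    by apply/TP; right.
  move=> a u v /TP uU /TP vU.
  case: uU vU => [[A chA Au]|Ju] [[B chB Bv]|Jv].
  (* The larger of the two members of the chain contains both elements. *)
  - have [AB|BA] := chain_tot _ _ chA chB.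
      by apply: (ub B) => //; apply/TP; left => //; apply: AB.
    by apply: (ub A) => //; apply/TP; left => //; apply: BA.
  - by apply: (ub A) => //; apply/TP; [left | right].
  - by apply: (ub B) => //; apply/TP; [right | left].
  by apply/TP; right; apply: JM.
pose I : idealr R := HB.pack (T A) (isIdealr.Build R (T A) TA).
have JI : {subset J <= I} by move=> x xJ; apply/TP; right.
exists I => // K IK x xK; apply/TP; left; apply: contrapT => nAx.
(* [K] contains [A] properly because of [x], and adjoining [J] to it changes nothing. *)
apply: (A_max [set z | z \in K]%classic).
  split; last by move=> /(_ x xK).
  by move=> z Az; apply: IK; apply/TP; left.
have TK : T [set z | z \in K]%classic =i K.
  move=> z; apply/TP/idP => [[//|zJ]|]; last by left.
  exact/IK/JI.
split; rewrite ?TK ?rpred0 ?idealr1 // => a u v; rewrite !TK => uK vK.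
by rewrite rpredD ?idealMr.
Qed.

(** * The substitution t := x + y *)

Section Shift.
Variable C : comNzRingType.

(* [p(t) |-> p(x + y)], where [y] is the outer variable and [x] the inner one. *)
Definition shift : {poly C} -> {poly {poly C}} :=
  comp_poly ('X + 'X%:P) \o map_poly polyC.

HB.instance Definition _ := GRing.RMorphism.on shift.

Lemma horner0_shift p : (shift p).[0] = p.
Proof.
by rewrite /shift /= horner_comp !hornerE -/(_ \Po _) comp_polyXr.
Qed.

Lemma shiftC (c : C) : shift c%:P = c%:P%:P.
Proof. by rewrite /shift /= map_polyC comp_polyC. Qed.

End Shift.

Local Notation sh := (map_mx (@shift _)).
Local Notation cst := (map_mx polyC).

Section MapShift.
Variables (C D : comNzRingType) (h : {rmorphism C -> D}).

Lemma map_shift p : map_poly (map_poly h) (shift p) = shift (map_poly h p).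
Proof.
rewrite /shift /= map_comp_poly rmorphD /= map_polyX map_polyC /= map_polyX.
rewrite -!map_poly_comp; congr (_ \Po _).
by apply: eq_map_poly => c /=; rewrite map_polyC.
Qed.

Lemma map_shift_mx l m (F : 'M[{poly C}]_(l, m)) :
  map_mx (map_poly (map_poly h)) (sh F) = sh (map_mx (map_poly h) F).
Proof. by apply/matrixP=> i j; rewrite !mxE map_shift. Qed.

Lemma map_polyC_mx l m (F : 'M[C]_(l, m)) :
  map_mx (map_poly h) (cst F) = cst (map_mx h F).
Proof. by apply/matrixP=> i j; rewrite !mxE map_polyC. Qed.

Lemma shift_at0 l m (F : 'M[{poly C}]_(l, m)) :
  sh (map_mx (map_poly h) (at0_mx F)) = cst (map_mx (map_poly h) (at0_mx F)).
Proof. by apply/matrixP=> i j; rewrite !mxE map_polyC shiftC. Qed.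

End MapShift.

(** * From local equivalence to an admissible translation, and the conclusion *)

Lemma translation_ideal_meets (R L : comNzRingType) (S : {pred R})
    (h : {rmorphism R -> L}) (l m : nat) (F : 'M[{poly R}]_(l, m)) :
  mulr_closed S -> fraction_map S idfun h ->
  equivalent_mx (map_mx (map_poly h) F) (map_mx (map_poly h) (at0_mx F)) ->
  exists2 s, s \in S & s \in translation_ideal F.
Proof.
move=> S_closed h_frac [U [V [[U' [UU' U'U]] [V' [VV' V'V]] hF]]].
have sh_inv n (P Q : 'M[{poly L}]_n) :
    P *m Q = 1%:M -> sh P *m sh Q = 1%:M.
  by rewrite -map_mxM => ->; apply: map_mx1.
have cst_inv n (P Q : 'M[{poly L}]_n) :
    P *m Q = 1%:M -> cst P *m cst Q = 1%:M.
  by rewrite -map_mxM => ->; apply: map_mx1.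
have at0_sh a b (P : 'M[{poly L}]_(a, b)) :
    map_mx (horner_eval 0) (sh P) = P.
  by apply/matrixP=> i j; rewrite !mxE horner_evalE horner0_shift.
have at0_cst a b (P : 'M[{poly L}]_(a, b)) :
    map_mx (horner_eval 0) (cst P) = P.
  by apply/matrixP=> i j; rewrite !mxE horner_evalE hornerC.
(* [sh] reads a matrix at x + y and [cst] at x, so the outer factors are U(x + y) U(x)^-1 and
   V(x)^-1 V(x + y). *)
have [||||||||s sp Fs] := equivalent_mx_dilation S_closed
    (fraction_map_poly S_closed h_frac)
    (r := polyC) (h := map_poly h)
    (K := sh F) (G := F)
    (U := sh U *m cst U') (U' := cst U *m sh U')
    (V := cst V' *m sh V) (V' := sh V' *m cst V).
- by apply/matrixP=> i j; rewrite !mxE horner_evalE horner0_shift.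
- by rewrite map_mxM at0_sh at0_cst.
- by rewrite map_mxM at0_sh at0_cst.
- by rewrite mulmxA -(mulmxA (sh U)) cst_inv // mulmx1 sh_inv.
- by rewrite mulmxA -(mulmxA (cst U)) sh_inv // mulmx1 cst_inv.
- by rewrite mulmxA -(mulmxA (cst V')) sh_inv // mulmx1 cst_inv.
- by rewrite mulmxA -(mulmxA (sh V')) cst_inv // mulmx1 sh_inv.
- rewrite map_shift_mx map_polyC_mx.
  (* F(0) is the same at x + y as at x, so after cancellation both sides are U(x + y) F(0) V(x +
     y). *)
  rewrite {1}hF !map_mxM shift_at0 hF !map_mxM !mulmxA.
  rewrite -(mulmxA _ (cst U')) cst_inv // mulmx1.
  by rewrite -(mulmxA _ (cst V)) cst_inv // mulmx1.
exists s => //; apply/translation_idealP=> A phi x y.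
(* [Fs] says F(x + s y) ~ F(x) over R[x, y]; [ev] specializes the two variables to the given points
   of [A]. *)
pose ev := horner_eval y \o map_poly (horner_eval x \o map_poly phi).
have := equivalent_mx_map ev Fs; congr equivalent_mx; apply/matrixP=> i j.
  rewrite !mxE /ev /= !horner_evalE map_dilation horner_comp /=.
  rewrite map_polyC !hornerE map_comp_poly horner_comp rmorphD /= map_polyX.
  rewrite map_polyC !hornerE /= !horner_evalE map_polyX hornerX -map_poly_comp.
  rewrite addrC hornerC; congr horner.
  by apply: eq_map_poly => c; rewrite /= horner_evalE map_polyC hornerC.
by rewrite !mxE /ev /= map_polyC horner_evalE hornerC.
Qed.

Lemma toloc_fraction_map (R : comNzRingType) (p : prime_idealr R) :
  fraction_map [predC p] idfun (@toloc R p).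
Proof.
split=> [b b0|u].
  have /toloc_eqP[w wp wb] : toloc p b == toloc p 0 by rewrite b0 rmorph0.
  by exists w => // t _; rewrite -mulrA wb !mulr0.
have [a [s sp us]] := toloc_frac u; exists s => // t _; exists (t * a).
by rewrite /= !rmorphM /= -us [u * _]mulrC mulrA.
Qed.

Lemma notin_prime_closed (R : comNzRingType) (p : prime_idealr R) :
  mulr_closed [predC p].
Proof. by split=> [|s t]; [exact: notin_prime1 | exact: notin_primeM]. Qed.

Theorem theorem3p2 (R : comNzRingType) (l m : nat) (F : 'M[{poly R}]_(l, m)) :
  (forall (I : idealr R) (I_max : maximal_ideal I),
     equivalent_mx (localize_mx (maximal_prime I_max) F)
                   (localize_mx (maximal_prime I_max) (at0_mx F))) ->
  equivalent_mx F (at0_mx F).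
Proof.
move=> F_loc; apply: translation_ideal1; apply: contraT => J1.
have [I I_max JI] := maximal_ideal_over (translation_ideal_closed J1).
have [s sI Js] := translation_ideal_meets (notin_prime_closed _)
  (toloc_fraction_map _) (F_loc I I_max).
by case/negP: sI; apply: JI.
Qed.
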